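(* Let $X$ be a Banach space which does not have the approximation property, and let $Z$ be the Banach space constructed from $X$ (and a sequence $\{x_n\}_{n=1}^\infty\subseteq X$) as described in the context. Then $Z$ does not have the approximation property.
   Context: All Banach spaces are over the real scalars. A Banach space $E$ has the approximation property if for every compact set $K\subseteq E$ and every $\varepsilon>0$ there is a bounded finite rank operator $T$ on $E$ with $\|Tx-x\|<\varepsilon$ for every $x\in K$. Construction of $Z$. Let $X$ be a Banach space without the approximation property. Let $\{x_n\}_{n=1}^\infty$ be a sequence of nonzero vectors in $X$ such that $\|x_n\|\le 1$ for all $n$, $\|x_n\|$ decreases (in the weak sense) to $0$, and the identity operator of $X$ cannot be approximated by finite rank operators on the compact set $K=\overline{\mathrm{conv}}\{x_n\}_{n=1}^\infty$; that is, there is $\varepsilon>0$ such that no bounded finite rank operator $T$ on $X$ satisfies $\|Tx-x\|<\varepsilon$ for all $x\in K$. (Such a sequence exists because $X$ lacks the approximation property, by a theorem of Grothendieck that every norm compact subset of a Banach space is contained in the closed convex hull of a sequence converging to $0$.) For $0<t<1$ put $U_t=\overline{\mathrm{conv}}\{\pm x_n/\|x_n\|^t\}_{n=1}^\infty$, a compact, convex, symmetric subset of $X$. Let $Y_t$ be the linear span of $U_t$ with the norm $|||x|||_t=\inf\{|\lambda| : \lambda^{-1}x\in U_t\}$ for $x\in Y_t$. Then $(Y_t,|||\cdot|||_t)$ is a Banach space with closed unit ball $U_t$, and for $s<t$ one has $U_s\subseteq U_t$ and $Y_s\subseteq Y_t\subseteq X$. For $0<s<t<1$ and $y\in Y_s$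 let $y\chi_{(s,t)}:(0,1)\to X$ be the function equal to $y$ on $(s,t)$ and $0$ elsewhere. Let $\mathcal Z$ be the linear span of $\{y\chi_{(s,t)} : 0<s<t<1,\ y\in Y_s\}$, functions which are equal almost everywhere being identified. Each $f\in\mathcal Z$ satisfies $f(r)\in Y_r$ for (almost) all $r$, and $\mathcal Z$ is normed by $\|f\|=\int_0^1|||f(r)|||_r\,dr$. The Banach space $Z$ is the completion of $\mathcal Z$ with respect to this norm. *)

(* Defs.v *)
From mathcomp Require Import all_boot all_order all_algebra.
From mathcomp Require Import all_classical all_reals all_analysis.

Set Implicit Arguments.
Unset Strict Implicit.
Unset Printing Implicit Defensive.

Import Order.TTheory GRing.Theory Num.Theory.
Import numFieldNormedType.Exports.

Local Open Scope classical_set_scope.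
Local Open Scope ring_scope.

Definition lin_span (R : realType) (V : lmodType R) (A : set V) : set V :=
  [set v | exists n (c : 'I_n -> R) (u : 'I_n -> V),
      (forall i, A (u i)) /\ v = \sum_(i < n) c i *: u i].

Definition closed_convex_hull (R : realType) (E : normedModType R)
    (A : set E) : set E :=
  closure (smallest (@convex_set R E) A).

Definition bounded_op (R : realType) (E F : normedModType R) (T : E -> F) :=
  exists M : R, forall x, `|T x| <= M * `|x|.

Definition finite_rank (R : realType) (E F : normedModType R) (T : E -> F) :=
  exists n (v : 'I_n -> F), range T `<=` lin_span (range v).

Definition id_approximable_on (R : realType) (E : normedModType R)
    (K : set E) :=
  forall eps : R, 0 < eps ->
    exists T : {linear E -> E},
      [/\ bounded_op T, finite_rank T & forall x, K x -> `|T x - x| < eps].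

Definition approximation_property (R : realType) (E : normedModType R) :=
  forall K : set E, compact K -> id_approximable_on K.

Section construction.
Context (R : realType) (X : completeNormedModType R) (x : nat -> X).

Definition U (t : R) : set X :=
  closed_convex_hull
    [set v | exists n, v = (`|x n| `^ t)^-1 *: x n \/
                       v = - ((`|x n| `^ t)^-1 *: x n)].

Definition Y (t : R) : set X := lin_span (U t).

(* [inf set0 = 0]: the value is meaningful only for [v] in [Y t]. *)
Definition Ynorm (t : R) (v : X) : R :=
  inf [set `|l| | l in [set l : R | l != 0 /\ U t (l^-1 *: v)]].

Definition step (s t : R) (y : X) : R -> X :=
  fun r => \1_(`]s, t[%classic) r *: y.

(* Elements are functions, not classes modulo almost everywhere equality: the
   identification is made by the completion map, see [is_completion]. *)
Definition calZ : set (R -> X) :=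
  lin_span [set f | exists s t y,
    [/\ 0 < s, s < t, t < 1, Y s y & f = step s t y]].

Definition calZnorm (f : R -> X) : R :=
  \int[lebesgue_measure]_(r in `]0, 1[) Ynorm r (f r).

End construction.

(* [Z] is, through [j], a completion of the linear subspace [D] of [V]
   seminormed by [N].  By linearity and isometry, [j f = j g] iff
   [N (f - g) = 0], so [j] factors through an isometric embedding of the
   normed space [D / {N = 0}].  On [calZ x], [calZnorm x (f - g) = 0] holds
   exactly when [f] and [g] are equal almost everywhere. *)
Definition is_completion (R : realType) (V : lmodType R) (D : set V)
    (N : V -> R) (Z : completeNormedModType R) (j : V -> Z) :=
  [/\ forall (a : R) f g, D f -> D g -> j (a *: f + g) = a *: j f + j g,
      forall f, D f -> `|j f| = N f
    & closure (j @` D) = [set: Z]].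

(* Main.v *)
From HB Require Import structures.
Require Import Defs.
From mathcomp Require Import all_boot all_order all_algebra.
From mathcomp Require Import all_classical all_reals all_analysis.
From mathcomp Require Import ring lra.
(** Assume that [Z] has the approximation property; the identity of [X] is then
    approximable on the closed convex hull of [x]. Fix [0 < s < t < 1].

    The map [J y = y * chi_(s, t)] sends [x n] to a vector [z n] of [Z] of norm
    at most [|x n| ^ s], so [z n] tends to [0] and [{0} + {z n}] is compact. A
    finite rank operator [T] on [Z] moves every [z n] by little. Write
    [T = sum_i phi_i * w_i] with continuous functionals [phi_i]
    ([finite_rank_decomposition]) and approximate [w_i] by functions [f_i] of
    the dense subspace. Integration over [(0, 1)] is a contraction from that
    subspace to [X] ([weak_integral_norm]), because the unit ball of [Y r] lies
    in the unit ball of [X]. It maps [J y] to [(t - s) y]. With [q_i] the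
    integral of [f_i], this makes [(t - s)^-1 sum_i phi_i (J (x n)) * q_i] close
    to [x n], uniformly in [n].

    The functionals [phi_i o J] are continuous for the norm of [Y s], not for
    that of [X]. The crux is that on the symmetric hull of [x] they are uniform
    limits of continuous functionals on [X] ([approx_functional_step]). Indeed
    that hull is totally bounded in [Y s], whose unit ball is closed in [X]. So
    among its elements, a small norm in [X] forces a small norm in [Y s]
    ([disk_totally_bounded_norm]). Hence for every [d > 0] there is [C] such
    that [psi = phi_i o J] satisfies [psi v <= d + C |v|] on the hull, and by
    the Mazur-Orlicz form of the Hahn-Banach theorem this is sufficient for the
    existence of a linear functional [f] on [X] with [f <= C |.|] and
    [|f - psi| <= d] on the hull ([approx_functional]).

    Replacing [phi_i o J] by such functionals gives a bounded finite rank
    operator on [X] which moves every [x n] by less than [eps]; the bound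
    extends to the closed convex hull ([approx_closed_convex_hull]). *)

Set Implicit Arguments.
Unset Strict Implicit.
Unset Printing Implicit Defensive.

Import Order.TTheory GRing.Theory Num.Theory.
Import numFieldNormedType.Exports.
Local Open Scope classical_set_scope.
Local Open Scope ring_scope.

(** * Sublinear functionals and the Hahn-Banach theorem *)

Definition sublinear (R : realType) (V : lmodType R) (p : V -> R) :=
  (forall u v, p (u + v) <= p u + p v) /\
  (forall a v, 0 < a -> p (a *: v) <= a * p v).

Definition scalar_of (R : realType) (V : lmodType R) (f : V -> R)
    (lf : scalar f) : {scalar V} :=
  HB.pack f (GRing.isLinear.Build R V R^o *:%R f lf).

Section Sublinear.
Variables (R : realType) (V : lmodType R) (p : V -> R).
Hypothesis hp : sublinear p.

Lemma sublinear0 : p 0 = 0.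
Proof.
have h1 := hp.1 0 0; have h2 : p (2^-1 *: 0) <= 2^-1 * p 0 by apply: hp.2; lra.
by rewrite scaler0 in h2; rewrite addr0 in h1; lra.
Qed.

Lemma sublinearN v : - p (- v) <= p v.
Proof. by have := hp.1 v (- v); rewrite subrr sublinear0; lra. Qed.

Lemma sublinearZ a v : 0 <= a -> p (a *: v) = a * p v.
Proof.
rewrite le_eqVlt => /orP[/eqP<-|a0]; first by rewrite scale0r sublinear0 mul0r.
apply/eqP; rewrite eq_le hp.2//= -ler_pdivlMl//.
have {1}-> : v = a^-1 *: (a *: v) by rewrite scalerA mulVf ?scale1r// gt_eqF.
by apply: hp.2; rewrite invr_gt0.
Qed.

Lemma odd_sublinear_linear : (forall v, p (- v) = - p v) ->
  exists f : {scalar V}, forall v, f v = p v.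
Proof.
move=> pN.
have lin : scalar p.
  move=> a u v; have pZ b w : p (b *: w) = b * p w.
    have [b0|/ltW b0] := leP 0 b; first exact: sublinearZ.
    rewrite -[b]opprK scaleNr pN sublinearZ ?oppr_ge0//; ring.
  rewrite -[X in _ = X + _]pZ; apply/eqP; rewrite eq_le hp.1/=.
  have := hp.1 (- (a *: u)) (- v); rewrite -opprD !pN; lra.
by exists (scalar_of lin).
Qed.

End Sublinear.

(** The witness is the infimal convolution [inf (p (v + w) - b)] over the pairs
    [(w, b)] of the cone [G]. A linear functional below [q] satisfies [b <= f w]
    for these pairs. *)
Lemma sublinear_inf_cone (R : realType) (V : lmodType R) (p : V -> R)
    (G : V -> R -> Prop) : sublinear p ->
  G 0 0 ->
  (forall w b w' b', G w b -> G w' b' -> G (w + w') (b + b')) ->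
  (forall a w b, 0 < a -> G w b -> G (a *: w) (a * b)) ->
  (forall w b, G w b -> b <= p w) ->
  exists q : V -> R, [/\ sublinear q, (forall v, q v <= p v)
    & forall w b, G w b -> q (- w) <= - b].
Proof.
move=> hp G0 GD GZ Gp.
pose S v := [set p (v + wb.1) - wb.2 | wb in [set wb : V * R | G wb.1 wb.2]].
have S0 v : S v !=set0 by exists (p (v + 0) - 0), (0, 0).
have lbS v : lbound (S v) (- p (- v)).
  move=> _ [[w b] /= Gw <-]; have := hp.1 (v + w) (- v).
  by rewrite addrC addKr; have := Gp _ _ Gw; lra.
have qle v w b : G w b -> inf (S v) <= p (v + w) - b.
  by move=> Gw; apply: ge_inf; [exists (- p (- v))|exists (w, b)].
exists (fun v => inf (S v)); split.
- split=> [u v|a v a0].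
    rewrite -lerBlDr; apply: lb_le_inf => // _ [[w b] /= Gw <-].
    rewrite lerBlDl -lerBlDr; apply: lb_le_inf => // _ [[w' b'] /= Gw' <-].
    have := qle (u + v) _ _ (GD _ _ _ _ Gw Gw'); rewrite addrACA.
    by have := hp.1 (u + w) (v + w'); lra.
  rewrite -ler_pdivrMl//; apply: lb_le_inf => // _ [[w b] /= Gw <-].
  rewrite ler_pdivrMl// mulrBr; apply: le_trans (qle _ _ _ (GZ _ _ _ a0 Gw)) _.
  by rewrite -scalerDr lerD2r; apply: hp.2.
- by move=> v; rewrite -[leRHS]subr0 -{2}[v]addr0; apply: qle.
- by move=> w b /(qle (- w)); rewrite addNr (sublinear0 hp) sub0r.
Qed.

(** Zorn's lemma applies because the pointwise infimum of a chain of sublinear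
    functionals below [p] is again sublinear: it is bounded below by
    [- p (- v)]. *)
Lemma minimal_sublinear (R : realType) (V : lmodType R) (p : V -> R) :
  sublinear p ->
  exists q : V -> R, [/\ sublinear q, (forall v, q v <= p v) &
    forall q', sublinear q' -> (forall v, q' v <= q v) -> q' = q].
Proof.
move=> hp.
pose T := {q : V -> R | sublinear q /\ forall v, q v <= p v}.
pose r : rel T := fun q q' => `[< forall v, sval q' v <= sval q v >].
have [||||q qmin] := @Zorn T r.
- by move=> q; apply/asboolP.
- move=> q1 q2 q3 /asboolP h1 /asboolP h2; apply/asboolP => v.
  exact: le_trans (h2 v) (h1 v).
- move=> [q1 hq1] [q2 hq2] /asboolP/= h1 /asboolP/= h2.
  apply: eq_exist; apply/funext => v; by apply/eqP; rewrite eq_le h1 h2.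
- move=> A Atot; have [[q0 Aq0]|A0] := pselect (A !=set0); last first.
    exists (exist _ p (conj hp (fun v => lexx (p v)))) => q Aq.
    by case: A0; exists q.
  pose S v := [set sval q v | q in A].
  have S0 v : S v !=set0 by exists (sval q0 v), q0.
  have lbS v : lbound (S v) (- p (- v)).
    move=> _ [q _ <-]; have [qs qp] := svalP q.
    by apply: le_trans (sublinearN qs v); rewrite lerN2.
  have infle v q : A q -> inf (S v) <= sval q v.
    by move=> Aq; apply: ge_inf; [exists (- p (- v))|exists q].
  have Ssub : sublinear (fun v => inf (S v)).
    split=> [u v|a v a0].
      rewrite -lerBlDr; apply: lb_le_inf => // _ [q1 Aq1 <-].
      rewrite lerBlDl -lerBlDr; apply: lb_le_inf => // _ [q2 Aq2 <-].
      rewrite lerBlDl.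
      have [/asboolP h|/asboolP h] := Atot _ _ Aq1 Aq2.
        apply: le_trans (infle _ _ Aq2) _.
        by apply: le_trans ((svalP q2).1.1 u v) _; rewrite lerD2r.
      apply: le_trans (infle _ _ Aq1) _.
      by apply: le_trans ((svalP q1).1.1 u v) _; rewrite lerD2l.
    rewrite -ler_pdivrMl//; apply: lb_le_inf => // _ [q Aq <-].
    rewrite ler_pdivrMl//; apply: le_trans (infle _ _ Aq) _.
    exact: (svalP q).1.2.
  have Sp v : inf (S v) <= p v.
    exact: le_trans (infle _ _ Aq0) ((svalP q0).2 v).
  exists (exist _ (fun v => inf (S v)) (conj Ssub Sp)) => q Aq.
  by apply/asboolP => v /=; apply: infle.
- exists (sval q); have [qs qp] := svalP q; split => // q' q's q'q.
  have q'p v : q' v <= p v by exact: le_trans (q'q v) (qp v).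
  have <- // : exist _ q' (conj q's q'p) = q.
  by apply: qmin; apply/asboolP.
Qed.

(** A minimal sublinear functional [q] is linear: its infimal convolution with
    the ray of the pairs [(a v, a (q v))] lies below [q], so it is equal to [q],
    and this yields [q (- v) = - q v]. *)
Theorem hahn_banach (R : realType) (V : lmodType R) (p : V -> R) :
  sublinear p -> exists f : {scalar V}, forall v, f v <= p v.
Proof.
move=> /minimal_sublinear[q [qs qp qmin]].
have qN v : q (- v) = - q v.
  have [||||q' [q's q'q h]] := @sublinear_inf_cone _ _ q
      (fun w b => exists2 a, 0 <= a & w = a *: v /\ b = a * q v) qs.
  - by exists 0 => //; rewrite scale0r mul0r.
  - move=> _ _ _ _ [a a0 [-> ->]] [b b0 [-> ->]]; exists (a + b).
      exact: addr_ge0.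
    by rewrite scalerDl mulrDl.
  - move=> c _ _ c0 [a a0 [-> ->]]; exists (c * a).
      by rewrite mulr_ge0// ltW.
    by rewrite scalerA mulrA.
  - by move=> _ _ [a a0 [-> ->]]; rewrite (sublinearZ qs).
  have {}h : q' (- v) <= - q v.
    by apply: h; exists 1 => //; rewrite scale1r mul1r.
  rewrite (qmin _ q's q'q) in h; apply/eqP; rewrite eq_le h/=.
  by have := sublinearN qs v; lra.
have [f fq] := odd_sublinear_linear qs qN.
by exists f => v; rewrite fq.
Qed.

(** The Hahn-Banach theorem with prescribed lower bounds [b <= f w]. The
    necessary condition [b <= p w] suffices because the pairs form a cone. *)
Theorem mazur_orlicz (R : realType) (V : lmodType R) (p : V -> R)
    (G : V -> R -> Prop) : sublinear p ->
  G 0 0 ->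
  (forall w b w' b', G w b -> G w' b' -> G (w + w') (b + b')) ->
  (forall a w b, 0 < a -> G w b -> G (a *: w) (a * b)) ->
  (forall w b, G w b -> b <= p w) ->
  exists f : {scalar V}, (forall v, f v <= p v) /\
    forall w b, G w b -> b <= f w.
Proof.
move=> hp G0 GD GZ Gp.
have [q [qs qp qG]] := sublinear_inf_cone hp G0 GD GZ Gp.
have [f fq] := hahn_banach qs; exists f; split=> [v|w b Gw].
  exact: le_trans (fq v) (qp v).
by have := le_trans (fq (- w)) (qG _ _ Gw); rewrite linearN lerN2.
Qed.

Lemma sublinear_norm (R : realType) (E : normedModType R) (C : R) :
  0 <= C -> sublinear (fun v : E => C * `|v|).
Proof.
move=> C0; split=> [u v|a v a0].
  by rewrite -mulrDr ler_wpM2l// ler_normD.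
by rewrite normrZ gtr0_norm// mulrCA.
Qed.

Lemma scalar_normP (R : realType) (E : normedModType R) (f : {scalar E})
    (C : R) : (forall v, f v <= C * `|v|) -> forall v, `|f v| <= C * `|v|.
Proof.
move=> fC v; rewrite ler_norml fC andbT.
by have := fC (- v); rewrite linearN normrN lerNl.
Qed.

Lemma norming_functional (R : realType) (E : normedModType R) (v : E) :
  exists f : {scalar E}, (forall u, `|f u| <= `|u|) /\ f v = `|v|.
Proof.
have ns : sublinear (fun u : E => 1 * `|u|) by exact: sublinear_norm.
have [||||f [fle fG]] := mazur_orlicz
    (G := fun w b => exists2 a, 0 <= a & w = a *: v /\ b = a * `|v|) ns.
- by exists 0 => //; rewrite scale0r mul0r.
- move=> _ _ _ _ [a a0 [-> ->]] [b b0 [-> ->]]; exists (a + b).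
    exact: addr_ge0.
  by rewrite scalerDl mulrDl.
- move=> c _ _ c0 [a a0 [-> ->]]; exists (c * a).
    by rewrite mulr_ge0// ltW.
  by rewrite scalerA mulrA.
- by move=> _ _ [a a0 [-> ->]]; rewrite mul1r normrZ ger0_norm.
have fv : `|v| <= f v by apply: fG; exists 1; rewrite ?scale1r ?mul1r.
exists f; split=> [u|]; first by rewrite -[leRHS]mul1r; apply: scalar_normP.
by apply/eqP; rewrite eq_le fv andbT -[leRHS]mul1r.
Qed.

(** * Linear spans and finite rank operators *)

Section LinSpan.
Variables (R : realType) (V : lmodType R) (A : set V).

Lemma sub_lin_span : A `<=` lin_span A.
Proof.
by move=> v Av; exists 1%N, (fun=> 1), (fun=> v); rewrite big_ord1 scale1r.
Qed.

Lemma lin_spanP a u v :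
  lin_span A u -> lin_span A v -> lin_span A (a *: u + v).
Proof.
move=> [n [c [f [Af ->]]]] [m [d [g [Ag ->]]]]; exists (n + m)%N,
  (fun i => match fintype.split i with inl k => a * c k | inr k => d k end),
  (fun i => match fintype.split i with inl k => f k | inr k => g k end).
split=> [i|]; first by case: (fintype.split i).
rewrite big_split_ord/= scaler_sumr; congr (_ + _); apply: eq_bigr => i _.
  by rewrite (unsplitK (inl i)) scalerA.
by rewrite (unsplitK (inr i)).
Qed.

Lemma lin_span0 : lin_span A 0.
Proof.
by exists 0%N, (fun=> 0), (fun=> 0); split=> [[]//|]; rewrite big_ord0.
Qed.

Lemma lin_spanZ a u : lin_span A u -> lin_span A (a *: u).
Proof. by move=> Au; rewrite -[_ *: _]addr0; apply: lin_spanP lin_span0. Qed.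

Lemma lin_span_sum n (c : 'I_n -> R) (f : 'I_n -> V) :
  (forall i, lin_span A (f i)) -> lin_span A (\sum_(i < n) c i *: f i).
Proof.
elim: n => [|n IHn] in c f * => Af.
  by rewrite big_ord0; exact: lin_span0.
by rewrite big_ord_recl; apply: lin_spanP => //; exact: IHn.
Qed.

End LinSpan.

Lemma lin_span_range (R : realType) (V : lmodType R) n (v : 'I_n -> V) w :
  lin_span (range v) w -> exists c : 'I_n -> R, w = \sum_(i < n) c i *: v i.
Proof.
move=> [m [c [u [uv ->]]]].
have /choice[g gu] : forall k, exists i, v i = u k.
  by move=> k; have [i _ <-] := uv k; exists i.
exists (fun i => \sum_(k < m | g k == i) c k).
rewrite (partition_big g xpredT)//=; apply: eq_bigr => i _.
by rewrite scaler_suml; apply: eq_bigr => k /eqP <-; rewrite gu.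
Qed.

(** The coordinates are produced by induction on the number of spanning
    vectors: a functional [f] norming the first vector [v 0] splits off the
    bounded rank one operator [z |-> f (T z) *: (v 0 / |v 0|)], and what
    remains is spanned by the vectors [v i - f (v i) *: (v 0 / |v 0|)]. *)
Lemma finite_rank_decomposition (R : realType) (E F : normedModType R) n
    (v : 'I_n -> F) (T : E -> F) : linear T -> bounded_op T ->
  (forall z, exists c : 'I_n -> R, T z = \sum_(i < n) c i *: v i) ->
  exists (phi : 'I_n -> {scalar E}) (w : 'I_n -> F) (M : R),
    [/\ 0 <= M, (forall i z, `|phi i z| <= M * `|z|) &
      forall z, T z = \sum_(i < n) phi i z *: w i].
Proof.
elim: n => [|n IHn] in v T * => lT [B TB] Tv.
  have phi0 : 'I_0 -> {scalar E} by case.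
  exists phi0, v, 0; split => // [[]//|z].
  by have [c ->] := Tv z; rewrite !big_ord0.
have [f [f1 fv]] := norming_functional (v ord0).
pose w0 := `|v ord0|^-1 *: v ord0.
have fw0 : f (v ord0) *: w0 = v ord0.
  have [->|v0] := eqVneq (v ord0) 0; first by rewrite linear0 scale0r.
  by rewrite fv /w0 scalerA divff ?scale1r// normr_eq0.
have nw0 : `|w0| <= 1.
  rewrite /w0 normrZ normfV normr_id.
  have [->|v0] := eqVneq (v ord0) 0; first by rewrite normr0 mulr0.
  by rewrite mulVf ?normr_eq0.
clearbody w0.
have lf0 : scalar (fun z => f (T z)) by move=> a y z; rewrite lT linearP.
pose phi0 : {scalar E} := scalar_of lf0.
pose T' z := T z - f (T z) *: w0.
have [|||phi [w [M [M0 phiM T'E]]]] :=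
    IHn (fun i => v (lift ord0 i) - f (v (lift ord0 i)) *: w0) T'.
- move=> a y z; rewrite /T' lT linearP/= scalerDl scalerBr opprD addrACA.
  by rewrite scalerA.
- exists (B + B) => z; apply: le_trans (ler_normB _ _) _; rewrite mulrDl lerD//.
  rewrite normrZ -[leRHS]mulr1 ler_pM//.
  exact: le_trans (f1 _) (TB z).
- move=> z; have [c Tz] := Tv z; exists (fun i => c (lift ord0 i)).
  have fTz : f (T z) = c ord0 * f (v ord0) +
      \sum_(i < n) c (lift ord0 i) * f (v (lift ord0 i)).
    rewrite Tz big_ord_recl linearD linearZ linear_sum/=; congr (_ + _).
    by apply: eq_bigr => i _; rewrite linearZ.
  rewrite /T' fTz Tz big_ord_recl scalerDl -scalerA fw0.
  rewrite opprD addrACA subrr add0r.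
  rewrite scaler_suml -sumrB; apply: eq_bigr => i _.
  by rewrite scalerBr scalerA.
have TE z : T z = f (T z) *: w0 + T' z by rewrite /T' addrC subrK.
exists (fun i => if unlift ord0 i is Some k then phi k else phi0),
  (fun i => if unlift ord0 i is Some k then w k else w0), (M + `|B|).
split=> [|i z|z]; first by rewrite addr_ge0.
- rewrite mulrDl; case: (unlift ord0 i) => [k|].
    by apply: le_trans (phiM k z) _; rewrite lerDl mulr_ge0.
  apply: le_trans (f1 _) _; apply: le_trans (TB z) _.
  rewrite -[leLHS]add0r lerD ?mulr_ge0// ler_wpM2r//; exact: ler_norm.
- rewrite big_ord_recl unlift_none {1}TE T'E; congr (_ + _).
  by apply: eq_bigr => i _; rewrite liftK.
Qed.

(** * Disks and closed convex hulls *)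

(** A bounded disk [B] is, up to its boundary, the unit ball of a norm on its
    span; [dilate t B] plays the part of the ball of radius [t]. *)
Definition disk (R : realType) (V : lmodType R) (B : set V) :=
  B 0 /\ forall a b u v, `|a| + `|b| <= 1 -> B u -> B v -> B (a *: u + b *: v).

Definition dilate (R : realType) (V : lmodType R) (t : R) (B : set V) : set V :=
  [set t *: u | u in B].

Section Disk.
Variables (R : realType) (V : lmodType R) (B : set V).
Hypothesis dB : disk B.
Implicit Types (s t a : R) (u v : V).

Lemma disk_scale a u : `|a| <= 1 -> B u -> B (a *: u).
Proof.
move=> a1 Bu; rewrite -[a *: u]addr0 -[X in _ + X](scale0r u).
by apply: dB.2 => //; rewrite normr0 addr0.
Qed.

Lemma dilate0 t : dilate t B 0.
Proof. by exists 0; [exact: dB.1|rewrite scaler0]. Qed.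

Lemma dilate1 u : B u -> dilate 1 B u.
Proof. by exists u; rewrite ?scale1r. Qed.

Lemma dilateD s t u v : 0 <= s -> 0 <= t ->
  dilate s B u -> dilate t B v -> dilate (s + t) B (u + v).
Proof.
move=> s0 t0 [u' Bu <-] [v' Bv <-].
have [st0|st0] := eqVneq (s + t) 0.
  have [-> ->] : s = 0 /\ t = 0 by split; lra.
  by rewrite !scale0r !addr0; exact: dilate0.
have st : 0 < s + t by rewrite lt_neqAle eq_sym st0 addr_ge0.
exists ((s / (s + t)) *: u' + (t / (s + t)) *: v').
  apply: dB.2 => //; rewrite !ger0_norm ?divr_ge0 ?(ltW st)//.
  by rewrite -mulrDl divff.
by rewrite scalerDr !scalerA !(mulrCA (s + t)) !divff// !mulr1.
Qed.

Lemma dilateZ a t u : dilate t B u -> dilate (`|a| * t) B (a *: u).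
Proof.
move=> [u' Bu <-]; exists (Num.sg a *: u').
  by apply: disk_scale => //; rewrite normr_sg; case: (a == 0).
by rewrite !scalerA; congr (_ *: _); rewrite [in RHS](numEsg a); ring.
Qed.

Lemma dilateN t u : dilate t B u -> dilate t B (- u).
Proof. by move=> /(dilateZ (-1)); rewrite normrN1 mul1r scaleN1r. Qed.

Lemma dilate_le s t u : 0 <= s <= t -> dilate s B u -> dilate t B u.
Proof.
move=> /andP[s0 st] Bu; rewrite -[u]addr0 -(subrKC s t).
by apply: dilateD => //; rewrite ?subr_ge0//; exact: dilate0.
Qed.

Lemma dilateE t u : 0 < t -> dilate t B u <-> B (t^-1 *: u).
Proof.
move=> t0; split=> [[v Bv <-]|Bu].
  by rewrite scalerA mulVf ?scale1r// gt_eqF.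
by exists (t^-1 *: u); rewrite // scalerA divff ?scale1r// gt_eqF.
Qed.

Lemma dilate_sum n (t : 'I_n -> R) (u : 'I_n -> V) : (forall i, 0 <= t i) ->
  (forall i, dilate (t i) B (u i)) ->
  dilate (\sum_(i < n) t i) B (\sum_(i < n) u i).
Proof.
elim: n => [|n IHn] in t u * => t0 Bu.
  by rewrite !big_ord0; exact: dilate0.
rewrite !big_ord_recl; apply: dilateD => //; first exact: sumr_ge0.
exact: IHn.
Qed.

End Disk.

Section Affine.
Variables (R : realType) (E : normedModType R).
Implicit Types (A B C : set E).

Lemma closed_affine_preimage B (a : R) (w : E) :
  closed B -> closed [set v | B (a *: v + w)].
Proof.
move=> cB; apply: (@preimage_closed _ _ (fun v : E => a *: v + w) B) => // v.
by move=> _; apply: cvgD; [apply: cvgZr; exact: cvg_id|exact: cvg_cst].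
Qed.

Lemma convex_setP A : convex_set A <->
  forall u v a, 0 <= a <= 1 -> A u -> A v -> A (a *: u + (1 - a) *: v).
Proof.
split=> [cA u v a /andP[a0 a1] Au Av|cA u v l].
  by have := cA u v (Itv01 a0 a1); rewrite !inE; apply.
rewrite !inE => Au Av; apply: cA => //; apply/andP; split.
  exact: ge0.
exact: le1.
Qed.

Lemma closed_convex_hull_sub A C : convex_set C -> closed C -> A `<=` C ->
  closed_convex_hull A `<=` C.
Proof.
move=> vC cC AC; rewrite [C in _ `<=` C](closure_id _).1//.
by apply: closureS; exact: smallest_sub.
Qed.

Lemma sub_closed_convex_hull A : A `<=` closed_convex_hull A.
Proof.
by move=> v Av; apply: subset_closure; exact: sub_gen_smallest.
Qed.

Lemma convex_closed_convex_hull A : convex_set (closed_convex_hull A).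
Proof.
have vS : convex_set (smallest (@convex_set R E) A).
  apply/convex_setP => u v a a01 Au Av C [vC AC].
  by move/convex_setP : (vC); apply=> //; [apply: Au|apply: Av].
apply/convex_setP => u v a a01 Au Av.
(* Fix the first point in the hull, then in its closure. *)
have h1 u' v' : smallest (@convex_set R E) A u' -> closed_convex_hull A v' ->
    closed_convex_hull A (a *: u' + (1 - a) *: v').
  move=> Au' Av'; rewrite addrC.
  suff : closed_convex_hull A `<=`
      [set v | closed_convex_hull A ((1 - a) *: v + a *: u')] by exact.
  rewrite [X in _ `<=` X](closure_id _).1; last first.
    by apply: closed_affine_preimage; exact: closed_closure.
  apply: closureS => w Aw /=; apply: subset_closure; rewrite addrC.
  by move/convex_setP : vS; apply.
suff : closed_convex_hull A `<=`
    [set u | closed_convex_hull A (a *: u + (1 - a) *: v)] by exact.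
rewrite [X in _ `<=` X](closure_id _).1; last first.
  by apply: closed_affine_preimage; exact: closed_closure.
by apply: closureS => w Aw /=; exact: h1.
Qed.

Lemma convex_disk B : disk B -> convex_set B.
Proof.
move=> dB; apply/convex_setP => u v a /andP[a0 a1] Bu Bv; apply: dB.2 => //.
by rewrite !ger0_norm ?subr_ge0// subrKC.
Qed.

Lemma disk_convex B : convex_set B -> disk B <->
  B !=set0 /\ forall u, B u -> B (- u).
Proof.
move=> /convex_setP vB; split=> [dB|[[w Bw] BN]].
  split=> [|u Bu]; first by exists 0; exact: dB.1.
  by rewrite -scaleN1r; apply: disk_scale => //; rewrite normrN1.
have B0 : B 0.
  have -> : 0 = 2^-1 *: w + (1 - 2^-1) *: - w.
    by rewrite scalerN -scalerBl (_ : _ - _ = 0) ?scale0r//; lra.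
  by apply: vB; [lra|exact: Bw|exact: BN].
have Bpos a u : 0 <= a <= 1 -> B u -> B (a *: u).
  by move=> a01 Bu; rewrite -[a *: u]addr0 -(scaler0 _ (1 - a)); exact: vB.
have Bscale a u : `|a| <= 1 -> B u -> B (a *: u).
  move=> a1 Bu; have [a0|a0] := leP 0 a.
    by apply: Bpos => //; rewrite a0 -(ger0_norm a0).
  rewrite -[a]opprK scaleNr; apply: BN; apply: Bpos => //.
  by rewrite oppr_ge0 ltW// -ltr0_norm.
split=> // a b u v ab Bu Bv.
have [a0|a0] := eqVneq a 0.
  rewrite a0 scale0r add0r; apply: Bscale => //.
  by rewrite a0 normr0 add0r in ab.
have [b0|b0] := eqVneq b 0.
  rewrite b0 scale0r addr0; apply: Bscale => //.
  by rewrite b0 normr0 addr0 in ab.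
pose s := `|a| + `|b|.
have s0 : 0 < s by rewrite addr_gt0// normr_gt0.
have -> : a *: u + b *: v =
    s *: ((`|a| / s) *: (Num.sg a *: u) + (1 - `|a| / s) *: (Num.sg b *: v)).
  have -> : 1 - `|a| / s = `|b| / s.
    by rewrite -[1](@divff _ s) ?gt_eqF// -mulrBl /s addrC addKr.
  rewrite scalerDr !scalerA !(mulrCA s) divff ?gt_eqF// !mulr1.
  by rewrite ![`|_| * _]mulrC -!numEsg.
apply: Bpos; first by rewrite ltW.
apply: vB.
- rewrite divr_ge0 ?(ltW s0)//= ler_pdivrMr// mul1r lerDl//.
- by apply: Bscale => //; rewrite normr_sg; case: (a == 0).
- by apply: Bscale => //; rewrite normr_sg; case: (b == 0).
Qed.

End Affine.

(** [U x t] is by definition the symmetric hull of the sequence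
    [x n / |x n| ^ t]. *)
Definition sym_hull (R : realType) (E : normedModType R) (x : nat -> E) :=
  closed_convex_hull [set v | exists n, v = x n \/ v = - x n].

Section SymHull.
Variables (R : realType) (E : normedModType R) (x : nat -> E).

Lemma closed_sym_hull : closed (sym_hull x).
Proof. exact: closed_closure. Qed.

Lemma sym_hull_gen n : sym_hull x (x n).
Proof. by apply: sub_closed_convex_hull; exists n; left. Qed.

Lemma sym_hull_genN n : sym_hull x (- x n).
Proof. by apply: sub_closed_convex_hull; exists n; right. Qed.

Lemma disk_sym_hull : disk (sym_hull x).
Proof.
have vS : convex_set (sym_hull x) by exact: convex_closed_convex_hull.
apply/disk_convex => //; split; first by exists (x 0); exact: sym_hull_gen.
suff : sym_hull x `<=` [set u | sym_hull x (-1 *: u + 0)].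
  by move=> h u /h/=; rewrite scaleN1r addr0.
apply: closed_convex_hull_sub.
- apply/convex_setP => u v a a01 /=; rewrite !addr0 !scaleN1r => Su Sv.
  rewrite opprD -!scalerN; by move/convex_setP : vS; apply.
- by apply: closed_affine_preimage; exact: closed_sym_hull.
- move=> _ [n [->|->]]/=; rewrite scaleN1r addr0 ?opprK.
    exact: sym_hull_genN.
  exact: sym_hull_gen.
Qed.

Lemma sym_hull_sub (B : set E) : disk B -> closed B -> (forall n, B (x n)) ->
  sym_hull x `<=` B.
Proof.
move=> dB cB Bx; apply: closed_convex_hull_sub => //; first exact: convex_disk.
move=> _ [n [->|->]]//; rewrite -scaleN1r; apply: disk_scale => //.
by rewrite normrN1.
Qed.

End SymHull.

(** * Total boundedness and approximation of functionals *)

(** Total boundedness of [A] in the norm with unit ball [B]. *)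
Definition disk_totally_bounded (R : realType) (E : normedModType R)
    (B A : set E) := forall d, 0 < d ->
  exists L : seq E, forall v, A v -> exists2 w, w \in L & dilate d B (v - w).

(** On a set which is totally bounded for the norm of [B], a small norm of [E]
    forces a small [B]-norm. Cover [A] by finitely many translates [w + d B].
    They are closed in [E], so each of them either contains [0], and then lies
    in [2 d B], or stays away from [0] in the norm of [E]. *)
Lemma disk_totally_bounded_norm (R : realType) (E : normedModType R)
    (A B : set E) : disk B -> closed B -> A `<=` B ->
  disk_totally_bounded B A -> forall d, 0 < d ->
  exists2 C, 0 <= C & forall v, A v -> dilate (d + C * `|v|) B v.
Proof.
move=> dB cB AB tA d d0.
pose e := d / 2; have e0 : 0 < e by rewrite divr_gt0.
have ee : e + e = d by rewrite /e; lra.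
have [L LA] := tA e e0.
have [C C0 CL] : exists2 C, 0 <= C & forall w, w \in L -> forall v,
    dilate e B (v - w) -> dilate d B v \/ 1 <= C * `|v|.
  elim: L {LA} => [|w L [C C0 CL]]; first by exists 0.
  suff [C' C'0 C'w] : exists2 C', 0 <= C' & forall v, dilate e B (v - w) ->
      dilate d B v \/ 1 <= C' * `|v|.
    exists (C + C'); first exact: addr_ge0.
    move=> w' /[!inE]/orP[/eqP->|w'L] v Bv.
      have [|h] := C'w v Bv; [by left|right].
      by apply: le_trans h _; rewrite mulrDl lerDr mulr_ge0.
    have [|h] := CL _ w'L v Bv; [by left|right].
    by apply: le_trans h _; rewrite mulrDl lerDl mulr_ge0.
  have [Bw|Bw] := pselect (dilate e B w).
    exists 0 => // v Bv; left; rewrite -(subrK w v) -ee.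
    by apply: dilateD; rewrite ?ltW.
  pose P := [set v | B (e^-1 *: v - e^-1 *: w)].
  have PE v : P v <-> dilate e B (v - w) by rewrite dilateE// scalerBr.
  have cP : closed P by exact: closed_affine_preimage.
  have P0 : (~` P) 0.
    by move/PE; rewrite sub0r => /(dilateN dB); rewrite opprK.
  have /nbhs_ballP[r /= r0 rP] : nbhs 0 (~` P).
    by apply: open_nbhs_nbhs; split => //; exact: closed_openC.
  exists r^-1; first by rewrite invr_ge0 ltW.
  move=> v /PE Pv; right; rewrite -ler_pdivrMl ?invr_gt0// invrK mulr1.
  rewrite leNgt; apply/negP => vr; apply: (rP v) => //.
  by rewrite -ball_normE/= sub0r normrN.
exists C => // v Av; have [w wL Bvw] := LA v Av.
have [dv|Cv] := CL w wL v Bvw.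
  apply: (dilate_le dB) dv; rewrite (ltW d0)/= lerDl; exact: mulr_ge0.
apply: (dilate_le dB) (dilate1 (AB v Av)); rewrite ler01/=.
by apply: le_trans Cv _; rewrite lerDr ltW.
Qed.

Lemma interval_net (R : realType) (e : R) : 0 < e ->
  exists L : seq R, forall b, `|b| <= 1 -> exists2 g, g \in L & `|b - g| <= e.
Proof.
move=> e0; pose m := (Num.truncn (2 / e)).+1.
exists [seq k%:R * e - 1 | k <- iota 0 m] => b.
rewrite ler_norml => /andP[b1 b2].
have be0 : 0 <= (b + 1) / e by rewrite divr_ge0 ?(ltW e0)//; lra.
have /andP[h1 h2] := truncn_itv be0.
exists ((Num.truncn ((b + 1) / e))%:R * e - 1).
  apply/mapP; exists (Num.truncn ((b + 1) / e)) => //.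
  rewrite mem_iota/= add0n ltnS; apply: le_truncn.
  by rewrite ler_pM2r ?invr_gt0//; lra.
rewrite ler_pdivlMr// in h1; rewrite ltr_pdivrMr// -natr1 in h2.
by rewrite ler_norml; apply/andP; split; lra.
Qed.

(** A box in finitely many coordinates has a finite net: refine a grid in one
    coordinate at a time. *)
Lemma box_net (R : realType) (E : normedModType R) (B : set E) (x : nat -> E) :
  disk B -> (forall n, B (x n)) -> forall N d, 0 < d ->
  exists L : seq E, forall b : nat -> R, (forall n, `|b n| <= 1) ->
    exists2 w, w \in L & dilate d B (\sum_(i < N) b i *: x i - w).
Proof.
move=> dB Bx; elim=> [|N IHN] d d0.
  exists [:: 0] => b b1; exists 0; first by rewrite inE.
  by rewrite big_ord0 subr0; exact: dilate0.
have d2 : 0 < d / 2 by rewrite divr_gt0.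
have [L hL] := IHN _ d2; have [G hG] := interval_net d2.
exists [seq w + g *: x N | w <- L, g <- G] => b b1.
have [w wL Bw] := hL b b1; have [g gG bg] := hG (b N) (b1 N).
exists (w + g *: x N); first by apply/allpairsP; exists (w, g).
rewrite big_ord_recr opprD addrACA -scalerBl /=.
rewrite (_ : d = d / 2 + d / 2); last lra.
apply: dilateD => //; rewrite ?(ltW d2)//.
apply: (dilate_le dB) (dilateZ dB _ (dilate1 (Bx N))).
by rewrite mulr1 normr_ge0.
Qed.

(** If [x] tends to [0] in the norm of [B], its symmetric hull is contained in
    [{sum_(i < N) b i *: x i | |b i| <= 1} + d B] for a large [N], because the
    terms of index at least [N] lie in [d B]. *)
Lemma sym_hull_totally_bounded (R : realType) (E : normedModType R)
    (B : set E) (x : nat -> E) : disk B -> closed B -> (forall n, B (x n)) ->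
  (forall d, 0 < d -> exists N, forall n, (N <= n)%N -> dilate d B (x n)) ->
  disk_totally_bounded B (sym_hull x).
Proof.
move=> dB cB Bx xB d d0.
pose e := d / 4; have e0 : 0 < e by rewrite divr_gt0.
have [N xN] := xB e e0; have [L hL] := box_net dB Bx N e0; exists L.
pose D := [set v | exists b : nat -> R, (forall n, `|b n| <= 1) /\
   dilate e B (v - \sum_(i < N) b i *: x i)].
have dD : disk D.
  split.
    exists (fun=> 0); split=> [n|]; first by rewrite normr0.
    by rewrite big1 ?subr0 => [|i _]; rewrite ?scale0r//; exact: dilate0.
  move=> a c u v ac [b [b1 Bu]] [b' [b'1 Bv]].
  exists (fun n => a * b n + c * b' n); split=> [n|].
    apply: le_trans (ler_normD _ _) _; apply: le_trans ac.
    by rewrite !normrM lerD// -[leRHS]mulr1 ler_wpM2l.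
  have -> : a *: u + c *: v - \sum_(i < N) (a * b i + c * b' i) *: x i =
      a *: (u - \sum_(i < N) b i *: x i) + c *: (v - \sum_(i < N) b' i *: x i).
    rewrite !scalerBr !scaler_sumr addrACA -opprD -big_split/=; congr (_ - _).
    by apply: eq_bigr => i _; rewrite scalerDl !scalerA.
  apply: (dilate_le dB) (dilateD dB _ _ (dilateZ dB a Bu) (dilateZ dB c Bv)).
  - apply/andP; split; first by rewrite addr_ge0// mulr_ge0// ltW.
    by rewrite -mulrDl -[leRHS]mul1r ler_wpM2r// ltW.
  - by rewrite mulr_ge0// ltW.
  - by rewrite mulr_ge0// ltW.
have xD n : D (x n).
  have [nN|Nn] := ltnP n N; last first.
    exists (fun=> 0); split=> [k|]; first by rewrite normr0.
    rewrite big1 ?subr0 => [|i _]; rewrite ?scale0r//; exact: xN.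
  exists (fun k => (k == n)%:R); split=> [k|].
    by case: (k == n); rewrite ?normr1// normr0.
  rewrite (bigD1 (Ordinal nN))//= eqxx scale1r big1 ?addr0 ?subrr.
    exact: dilate0.
  by move=> i /negPf; rewrite -val_eqE/= => ->; rewrite scale0r.
(* [D] lies in the union of the translates [w + 2 e B], [w] in [L], which is
   closed because it is finite. Hence the closed hull lies there as well. *)
have cL : closed [set v | exists2 w, w \in L & dilate (e + e) B (v - w)].
  have -> : [set v | exists2 w, w \in L & dilate (e + e) B (v - w)] =
      \bigcup_(w in [set` L]) [set v | B ((e + e)^-1 *: v - (e + e)^-1 *: w)].
    have ee0 : 0 < e + e by rewrite addr_gt0.
    apply/seteqP; split=> [v [w wL Bvw]|v [w wL Bvw]]; exists w => //=.
      by rewrite -scalerBr -dilateE.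
    by rewrite dilateE// scalerBr.
  apply: closed_bigcup; first exact: finite_seq.
  by move=> w _; exact: closed_affine_preimage.
suff h : sym_hull x `<=`
    [set v | exists2 w, w \in L & dilate (e + e) B (v - w)].
  move=> v /h[w wL Bvw]; exists w => //; apply: (dilate_le dB) Bvw.
  by apply/andP; split; rewrite /e; lra.
have vD := convex_disk dD.
rewrite [X in _ `<=` X](closure_id _).1//; apply: closureS => v.
move/(_ D); case.
  split=> // w [n [->|->]]//; rewrite -scaleN1r.
  by apply: (disk_scale dD) => //; rewrite normrN1.
move=> b [b1 Bv]; have [w wL Bw] := hL b b1; exists w => //.
rewrite -(subrKA (\sum_(i < N) b i *: x i)).
by apply: dilateD => //; rewrite ltW.
Qed.

(** Density of the continuous functionals on [E] among the functionals which
    are small on the part of [A] close to [0]: the bound on [psi] says exactly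
    that the constraints [psi w - d t <= f w], for [w] in [t A], are compatible
    with [f <= C |.|], which is the criterion for a common solution [f]. *)
Lemma approx_functional (R : realType) (E : normedModType R) (A D : set E)
    (psi : E -> R) : disk A ->
  (forall a u v, D u -> D v -> D (a *: u + v)) ->
  (forall a u v, D u -> D v -> psi (a *: u + v) = a * psi u + psi v) ->
  A `<=` D ->
  (forall d, 0 < d ->
    exists2 C, 0 <= C & forall v, A v -> psi v <= d + C * `|v|) ->
  forall d, 0 < d -> exists (f : {scalar E}) (C : R), [/\ 0 <= C,
    (forall v, `|f v| <= C * `|v|) & forall v, A v -> `|f v - psi v| <= d].
Proof.
move=> dA DL psiL AD psiA d d0.
have [C C0 hC] := psiA d d0.
have D0 : D 0 by apply: AD; exact: dA.1.
have psi0 : psi 0 = 0.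
  by have := psiL 1 0 0 D0 D0; rewrite scaler0 addr0 mul1r; lra.
have psiZ a u : D u -> psi (a *: u) = a * psi u.
  by move=> Du; rewrite -[a *: u]addr0 psiL// psi0 addr0.
have DZ a u : D u -> D (a *: u) by move=> Du; rewrite -[a *: u]addr0; exact: DL.
pose G w b := exists2 t, 0 <= t & dilate t A w /\ b = psi w - d * t.
have GD w t : dilate t A w -> D w by move=> [u Au <-]; apply: DZ; exact: AD.
have [||||f [fC fG]] := mazur_orlicz (G := G) (sublinear_norm E C0).
- by exists 0; rewrite // mulr0 psi0 subr0; split=> //; exact: dilate0.
- move=> w _ w' _ [t t0 [Aw ->]] [t' t'0 [Aw' ->]]; exists (t + t').
    exact: addr_ge0.
  split; first exact: dilateD.
  have := psiL 1 _ _ (GD _ _ Aw) (GD _ _ Aw'); rewrite scale1r mul1r => ->.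
  by ring.
- move=> a w _ a0 [t t0 [Aw ->]]; exists (`|a| * t); first exact: mulr_ge0.
  split; first exact: dilateZ.
  by rewrite (psiZ _ _ (GD _ _ Aw)) gtr0_norm//; ring.
- move=> _ _ [t t0 [[u Au <-] ->]]; rewrite psiZ; last exact: AD.
  rewrite normrZ ger0_norm// mulrCA (mulrC d) -mulrBr ler_wpM2l//.
  by rewrite lerBlDl; exact: hC.
have low w : A w -> psi w - d <= f w.
  move=> Aw; apply: fG; exists 1 => //; split; first exact: dilate1.
  by rewrite mulr1.
exists f, C; split=> // [|v Av]; first exact: scalar_normP.
have /low : A (- v) by rewrite -scaleN1r; apply: disk_scale; rewrite ?normrN1.
have psiN : psi (- v) = - psi v.
  by rewrite -scaleN1r psiZ ?mulN1r//; exact: AD.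
have := low v Av; rewrite linearN psiN.
by rewrite ler_norml => h1 h2; apply/andP; split; lra.
Qed.

(** * The spaces [Y t] *)

Section Gauge.
Variables (R : realType) (X : completeNormedModType R) (x : nat -> X).
Implicit Types (s t d : R).

Lemma U_gen t n : U x t ((`|x n| `^ t)^-1 *: x n).
Proof. exact: (@sym_hull_gen _ _ (fun n => (`|x n| `^ t)^-1 *: x n)). Qed.

Lemma closed_U t : closed (U x t).
Proof. exact: closed_sym_hull. Qed.

Lemma disk_U t : disk (U x t).
Proof. exact: disk_sym_hull. Qed.

Lemma Ynorm_le t (tau : R) v : 0 <= tau -> dilate tau (U x t) v ->
  Ynorm x t v <= tau.
Proof.
move=> tau0 Uv; apply/ler_addgt0Pr => e e0.
have te : 0 < tau + e by rewrite ltr_wpDl.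
apply: ge_inf; first by exists 0 => _ [l _ <-].
exists (tau + e); last by rewrite gtr0_norm.
split; first by rewrite gt_eqF.
rewrite -dilateE//; apply: (dilate_le (disk_U t)) Uv.
by rewrite tau0 lerDl ltW.
Qed.

Hypotheses (x_neq0 : forall n, x n != 0) (x_le1 : forall n, `|x n| <= 1).

Let nx0 n : 0 < `|x n|. Proof. by rewrite normr_gt0. Qed.

Lemma normx_powR_le1 n t : 0 <= t -> `|x n| `^ t <= 1.
Proof. by move=> t0; rewrite -(powRr0 `|x n|) ger_powR// nx0 x_le1. Qed.

Lemma x_dilate_U t n : dilate (`|x n| `^ t) (U x t) (x n).
Proof.
exists ((`|x n| `^ t)^-1 *: x n); first exact: U_gen.
by rewrite scalerA divff ?scale1r// gt_eqF// powR_gt0.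
Qed.

Lemma U_x t n : 0 <= t -> U x t (x n).
Proof.
move=> t0; have := x_dilate_U t n.
move/(dilate_le (disk_U t) (t := 1)); rewrite powR_ge0 normx_powR_le1//.
by move=> /(_ isT)/dilateE; rewrite invr1 scale1r; apply.
Qed.

Lemma U_mono s t : s <= t -> U x s `<=` U x t.
Proof.
move=> st; apply: sym_hull_sub => [||n]; [exact: disk_U|exact: closed_U|].
have -> : (`|x n| `^ s)^-1 *: x n =
    `|x n| `^ (t - s) *: ((`|x n| `^ t)^-1 *: x n).
  rewrite scalerA powRB; last by apply/implyP; rewrite normr_eq0 x_neq0.
  by rewrite mulrAC divff ?mul1r// gt_eqF// powR_gt0.
apply: (disk_scale (disk_U t)); last exact: U_gen.
by rewrite ger0_norm ?powR_ge0// normx_powR_le1// subr_ge0.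
Qed.

Lemma sym_hull_sub_U t : 0 <= t -> sym_hull x `<=` U x t.
Proof.
move=> t0; apply: sym_hull_sub => [||n]; [exact: disk_U|exact: closed_U|].
exact: U_x.
Qed.

Lemma U_norm_le1 t v : t <= 1 -> U x t v -> `|v| <= 1.
Proof.
move=> t1 Uv; suff : U x t `<=` [set v | `|v| <= 1] by move/(_ _ Uv).
apply: sym_hull_sub => [||n/=].
- split=> [|a b u w ab /= u1 w1]; first by rewrite /= normr0.
  apply: le_trans (ler_normD _ _) _; apply: le_trans ab.
  by rewrite !normrZ lerD// -[leRHS]mulr1 ler_wpM2l.
- rewrite (_ : [set v | _] = (fun u : X => `|u|) @^-1` [set r | r <= 1])//.
  apply: preimage_closed; last exact: closed_le.
  by move=> u _; exact: norm_continuous.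
- rewrite normrZ normfV (ger0_norm (powR_ge0 _ _)) mulrC.
  by rewrite ler_pdivrMr ?powR_gt0// mul1r ger1_powR// nx0 x_le1.
Qed.

(** That [v] lies in some dilate of [U x t] is essential: otherwise [Ynorm] is
    the infimum of the empty set, which is [0]. *)
Lemma norm_le_Ynorm t (tau : R) v : 0 <= tau -> t <= 1 ->
  dilate tau (U x t) v -> `|v| <= Ynorm x t v.
Proof.
move=> tau0 t1 Uv; apply: lb_le_inf.
  exists `|tau + 1|, (tau + 1) => //=.
  have t10 : 0 < tau + 1 by rewrite ltr_wpDl.
  split; first by rewrite gt_eqF.
  rewrite -dilateE//; apply: (dilate_le (disk_U t)) Uv.
  by rewrite tau0 lerDl ler01.
move=> _ [l [l0 Ul] <-]; have := U_norm_le1 t1 Ul.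
by rewrite normrZ normfV mulrC ler_pdivrMr ?normr_gt0// mul1r.
Qed.

Hypothesis x_cvg0 : (fun n => `|x n|) @ \oo --> (0 : R).

Lemma normx_powR_cvg0 t d : 0 < t -> 0 < d ->
  exists N, forall n, (N <= n)%N -> `|x n| `^ t <= d.
Proof.
move=> t0 d0; have dt : 0 < d `^ t^-1 by rewrite powR_gt0.
have /cvgrPdist_lt/(_ _ dt)[N _ hN] := x_cvg0.
exists N => n Nn; have := hN n Nn; rewrite /= sub0r normrN normr_id => /ltW xd.
rewrite -[leRHS](powRr1 (ltW d0)) -(@mulVf _ t) ?gt_eqF// powRrM.
by apply: ge0_ler_powR; rewrite ?nnegrE ?normr_ge0 ?(ltW dt) ?(ltW t0).
Qed.

(** The norm of [x n] in [Y t] is at most [|x n| ^ t] and tends to [0]. Hence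
    the symmetric hull of [x] is totally bounded in [Y t], and there the norm of
    [X] controls the stronger norm of [Y t] near [0]. *)
Lemma sym_hull_dilate_U t d : 0 < t -> 0 < d -> exists2 C, 0 <= C &
  forall v, sym_hull x v -> dilate (d + C * `|v|) (U x t) v.
Proof.
move=> t0 d0; have t0' := ltW t0.
apply: disk_totally_bounded_norm d0; [exact: disk_U|exact: closed_U| |].
  exact: sym_hull_sub_U.
apply: sym_hull_totally_bounded => [||n|e e0].
- exact: disk_U.
- exact: closed_U.
- exact: U_x.
have [N hN] := normx_powR_cvg0 t0 e0; exists N => n Nn.
by apply: (dilate_le (disk_U t)) (x_dilate_U t n); rewrite powR_ge0 hN.
Qed.

Lemma Y_dilate t v : Y x t v ->
  exists2 tau, 0 <= tau & forall r, t <= r -> dilate tau (U x r) v.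
Proof.
move=> [n [c [u [Uu ->]]]]; exists (\sum_(i < n) `|c i| * 1).
  by apply: sumr_ge0 => i _; rewrite mulr1.
move=> r tr; apply: dilate_sum => [|i|i]; [exact: disk_U|by rewrite mulr1|].
apply: dilateZ; [exact: disk_U|apply: dilate1; exact: (U_mono tr)].
Qed.

End Gauge.

(** * Step functions and their integrals *)

(** Nonmeasurable functions are covered, because the integral of a nonnegative
    function is a supremum over simple functions. The upper bound [M] makes the
    integrals finite. *)
Lemma le_Rintegral01 (R : realType) (g h : R -> R) (M : R) :
  (forall r, 0 < r < 1 -> 0 <= g r <= h r) ->
  (forall r, 0 < r < 1 -> h r <= M) ->
  \int[lebesgue_measure]_(r in `]0, 1[) g r <=
    \int[lebesgue_measure]_(r in `]0, 1[) h r <= M.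
Proof.
move=> gh hM; pose D : set R := `]0, 1[%classic.
have DE r : D r -> 0 < r < 1 by rewrite /D /= in_itv.
have muD : lebesgue_measure D = 1%E.
  by rewrite /D lebesgue_measure_itv/= lte_fin ltr01 oppr0 adde0.
have mono f1 f2 : (forall r, D r -> 0 <= f1 r <= f2 r) ->
    (\int[lebesgue_measure]_(r in D) (f1 r)%:E <=
     \int[lebesgue_measure]_(r in D) (f2 r)%:E)%E.
  move=> f12; rewrite !ge0_integralE; last 2 first.
  - by move=> r /f12 /andP[f10 f1f2]; rewrite lee_fin (le_trans f10).
  - by move=> r /f12 /andP[f10 _]; rewrite lee_fin.
  apply: le_ereal_sup => _ [k /= kf <-]; exists k => //= r.
  apply: le_trans (kf r) _; apply: lee_restrict => u /f12 /andP[_].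
  by rewrite lee_fin.
have le1 := mono g h (fun r Dr => gh r (DE r Dr)).
have le2 : (\int[lebesgue_measure]_(r in D) (h r)%:E <= M%:E)%E.
  have -> : M%:E = (\int[lebesgue_measure]_(r in D) M%:E)%E.
    by rewrite integral_cst ?/D//= muD mule1.
  apply: mono => r /DE r01; have /andP[g0 gh'] := gh r r01.
  by rewrite (le_trans g0 gh') hM.
have h0 : (0 <= \int[lebesgue_measure]_(r in D) (g r)%:E)%E.
  by apply: integral_ge0 => r /DE /gh /andP[g0 _]; rewrite lee_fin.
have fh : (\int[lebesgue_measure]_(r in D) (h r)%:E)%E \is a fin_num.
  by rewrite ge0_fin_numE ?(le_lt_trans le2) ?ltry// (le_trans h0).
have fg : (\int[lebesgue_measure]_(r in D) (g r)%:E)%E \is a fin_num.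
  by rewrite ge0_fin_numE// (le_lt_trans le1)// -ge0_fin_numE// (le_trans h0).
by rewrite /Rintegral fine_le//= -lee_fin fineK.
Qed.

(** The integral of a step function is a finite sum, so it can be tested against
    all linear functionals, continuous or not. *)
Definition weak_integral (R : realType) (X : normedModType R) (f : R -> X)
    (v : X) := forall phi : {scalar X},
  lebesgue_measure.-integrable `]0, 1[ (EFin \o (fun r => phi (f r))) /\
  \int[lebesgue_measure]_(r in `]0, 1[) phi (f r) = phi v.

Section WeakIntegral.
Variables (R : realType) (X : normedModType R).
Implicit Types (f g : R -> X) (v w : X).

Lemma weak_integral0 : weak_integral (0 : R -> X) 0.
Proof.
move=> phi; have -> : (fun r : R => phi ((0 : R -> X) r)) = fun=> 0.
  by apply/funext => r; rewrite linear0.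
by split; [exact: integrable0|rewrite Rintegral_cst//= mul0r linear0].
Qed.

Lemma weak_integralP a f g v w : weak_integral f v -> weak_integral g w ->
  weak_integral (a *: f + g) (a *: v + w).
Proof.
move=> fv gw phi; have [fi fE] := fv phi; have [gi gE] := gw phi.
have -> : (fun r => phi ((a *: f + g) r)) = fun r => a * phi (f r) + phi (g r).
  by apply/funext => r; rewrite -[RHS](linearP phi).
have afi : lebesgue_measure.-integrable `]0, 1[
    (EFin \o (fun r => a * phi (f r))).
  rewrite (_ : _ \o _ = fun r => (a%:E * (EFin \o (fun r => phi (f r))) r)%E).
    exact: integrableZl.
  by apply/funext => r /=; rewrite EFinM.
split; last by rewrite RintegralD// RintegralZl// fE gE linearP.
rewrite (_ : _ \o _ =
    ((EFin \o (fun r => a * phi (f r))%R) \+ (EFin \o (fun r => phi (g r))))%E).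
  exact: integrableD.
by apply/funext => r /=; rewrite EFinD.
Qed.

Lemma weak_integral_sum n (c : 'I_n -> R) (f : 'I_n -> R -> X) (v : 'I_n -> X) :
  (forall i, weak_integral (f i) (v i)) ->
  weak_integral (\sum_(i < n) c i *: f i) (\sum_(i < n) c i *: v i).
Proof.
elim: n => [|n IHn] in c f v * => fv.
  by rewrite !big_ord0; exact: weak_integral0.
by rewrite !big_ord_recl; apply: weak_integralP => //; exact: IHn.
Qed.

End WeakIntegral.

Lemma weak_integral_step (R : realType) (X : completeNormedModType R) (s t : R)
    (y : X) : 0 < s -> s < t -> t < 1 ->
  weak_integral (step s t y) ((t - s) *: y).
Proof.
move=> s0 st t1 phi.
have phiE : (fun r => phi (step s t y r)) = fun r => phi y * \1_(`]s, t[) r.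
  by apply/funext => r; rewrite /step linearZ/= mulrC.
have i1 : lebesgue_measure.-integrable `]0, 1[
    (EFin \o (\1_(`]s, t[%classic) : R -> R)).
  by apply: integrableS (integrable_indic_itv s t false true).
rewrite phiE; split.
  rewrite (_ : _ \o _ =
      fun r => ((phi y)%:E * (EFin \o (\1_(`]s, t[%classic) : R -> R)) r)%E).
    exact: integrableZl.
  by apply/funext => r /=; rewrite EFinM.
rewrite RintegralZl// linearZ/= mulrC; congr (_ * _).
rewrite /Rintegral integral_indic// setIidl; last first.
  move=> r /=; rewrite !in_itv/= => /andP[sr rt].
  by rewrite (lt_trans s0 sr) (lt_trans rt t1).
have mu_st : lebesgue_measure (`]s, t[%classic : set R) = (t - s)%:E.
  by rewrite lebesgue_measure_itv/= lte_fin st -EFinB.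
exact: (congr1 fine mu_st).
Qed.

Section CalZ.
Variables (R : realType) (X : completeNormedModType R) (x : nat -> X).
Hypotheses (x_neq0 : forall n, x n != 0) (x_le1 : forall n, `|x n| <= 1).

Lemma calZ_step s t y : 0 < s -> s < t -> t < 1 -> Y x s y ->
  calZ x (step s t y).
Proof.
by move=> s0 st t1 Yy; apply: sub_lin_span; exists s, t, y.
Qed.

Lemma calZ_weak_integral f : calZ x f -> exists v, weak_integral f v.
Proof.
move=> [n [c [u [hu ->]]]].
have /choice[v hv] : forall i, exists v, weak_integral (u i) v.
  move=> i; have [s [t [y [s0 st t1 _ ->]]]] := hu i.
  by exists ((t - s) *: y); exact: weak_integral_step.
by exists (\sum_(i < n) c i *: v i); exact: weak_integral_sum.
Qed.

Lemma step_dilate s t y (tau : R) r : (s <= r -> dilate tau (U x r) y) ->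
  dilate tau (U x r) (step s t y r).
Proof.
move=> hy; rewrite /step indicE; case: (boolP (r \in _)) => [|_] /=.
  by rewrite inE/= in_itv/= scale1r => /andP[/ltW sr _]; exact: hy.
by rewrite scale0r; exact: dilate0 (disk_U x r) tau.
Qed.

Lemma calZ_bounded f : calZ x f ->
  exists2 tau, 0 <= tau & forall r, dilate tau (U x r) (f r).
Proof.
move=> [n [c [u [hu ->]]]].
have /choice[tau htau] : forall i, exists tau, 0 <= tau /\
    forall r, dilate tau (U x r) (u i r).
  move=> i; have [s [t [y [s0 st t1 Yy ->]]]] := hu i.
  have [tau tau0 hy] := Y_dilate x_neq0 x_le1 Yy.
  by exists tau; split=> // r; apply: step_dilate; exact: hy.
exists (\sum_(i < n) `|c i| * tau i).
  by apply: sumr_ge0 => i _; rewrite mulr_ge0// (htau i).1.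
move=> r; rewrite fct_sumE; apply: dilate_sum => [|i|i]; first exact: disk_U.
  by rewrite mulr_ge0// (htau i).1.
by apply: dilateZ; [exact: disk_U|exact: (htau i).2].
Qed.

Lemma calZnorm_le f (tau : R) : 0 <= tau ->
  (forall r, 0 < r < 1 -> dilate tau (U x r) (f r)) -> calZnorm x f <= tau.
Proof.
move=> tau0 fU; have le_tau r : 0 < r < 1 -> 0 <= Ynorm x r (f r) <= tau.
  move=> r01; rewrite Ynorm_le ?andbT//; last exact: fU.
  have /andP[_ /ltW r1] := r01.
  exact: le_trans (normr_ge0 _) (norm_le_Ynorm x_neq0 x_le1 tau0 r1 (fU r r01)).
have h1 r : 0 < r < 1 -> 0 <= Ynorm x r (f r) <= Ynorm x r (f r).
  by move=> /le_tau /andP[-> _] /=.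
have h2 r : 0 < r < 1 -> Ynorm x r (f r) <= tau by move=> /le_tau /andP[].
by have /andP[] := le_Rintegral01 h1 h2.
Qed.

(** Integration is a contraction into [X]: evaluate a functional norming the
    integral [v], and use that the unit ball of [Y r] lies in the unit ball of
    [X], so that [|f r| <= Ynorm x r (f r)]. *)
Lemma weak_integral_norm f v : calZ x f -> weak_integral f v ->
  `|v| <= calZnorm x f.
Proof.
move=> /calZ_bounded[tau tau0 fU] fv.
have [phi [phi1 <-]] := norming_functional v.
have [phii <-] := fv phi.
apply: le_trans (ler_norm _) _.
apply: le_trans (le_normr_Rintegral _ phii) _ => //.
have h1 r : 0 < r < 1 -> 0 <= `|phi (f r)| <= Ynorm x r (f r).
  move=> /andP[_ /ltW r1]; rewrite normr_ge0 (le_trans (phi1 _))//.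
  exact: (norm_le_Ynorm x_neq0 x_le1 tau0 r1 (fU r)).
have h2 r : 0 < r < 1 -> Ynorm x r (f r) <= tau by move=> _; exact: Ynorm_le.
by have /andP[] := le_Rintegral01 h1 h2.
Qed.

End CalZ.

(** * The space [Z] *)

Lemma compact_cvg_range (T : topologicalType) (u : nat -> T) (l : T) :
  u @ \oo --> l -> compact (l |` range u).
Proof.
move=> ul F FF FA; have [cl|ncl] := pselect (cluster F l).
  by exists l; split=> //; left.
have [B [W [FB [lW BW]]]] : exists B W, F B /\ nbhs l W /\ B `&` W = set0.
  apply: contrapT => h; apply: ncl => B W FB lW; apply/set0P/negP => /eqP BW.
  by apply: h; exists B, W.
have [N _ hN] := ul _ lW.
have finA : finite_set (u @` `I_N) by apply: finite_image; exact: finite_II.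
have FN : F (u @` `I_N).
  apply: filterS (filterI FA FB) => v [[->|[n _ <-]] Bv].
    have : (B `&` W) l by split=> //; exact: nbhs_singleton lW.
    by rewrite BW.
  exists n => //=; rewrite ltnNge; apply/negP => Nn.
  have : (B `&` W) (u n) by split=> //; exact: hN.
  by rewrite BW.
have [v [[n _ <-] cv]] := finite_compact finA FF FN.
by exists (u n); split=> //; right; exists n.
Qed.

(** The set of vectors moved by at most [e] is closed and convex. *)
Lemma approx_closed_convex_hull (R : realType) (E : normedModType R)
    (S : {linear E -> E}) (A : set E) (e : R) : bounded_op S ->
  (forall v, A v -> `|S v - v| <= e) ->
  forall v, closed_convex_hull A v -> `|S v - v| <= e.
Proof.
move=> [M SM] SA.
suff : closed_convex_hull A `<=` [set v | `|S v - v| <= e] by [].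
have Scont : continuous S.
  apply/linear_bounded_continuous/linear_boundedP.
  exists `|M|; split; first exact: num_real.
  move=> r Mr v /=; apply: le_trans (SM v) _; rewrite ler_wpM2r//.
  by apply: le_trans (ltW Mr); exact: ler_norm.
apply: closed_convex_hull_sub => //.
- apply/convex_setP => u v a /andP[a0 a1] /= hu hv.
  rewrite linearD !linearZ/= opprD addrACA -!scalerBr.
  apply: le_trans (ler_normD _ _) _; rewrite !normrZ !ger0_norm ?subr_ge0//.
  rewrite [leRHS](_ : e = a * e + (1 - a) * e); last by ring.
  by rewrite lerD// ler_wpM2l// subr_ge0.
- rewrite (_ : [set v | _] =
    (fun v : E => `|S v - v|) @^-1` [set r | r <= e])//.
  apply: preimage_closed; last exact: closed_le.
  move=> v _; apply: cvg_norm; apply: cvgB; [exact: Scont|exact: cvg_id].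
Qed.

Definition linear_of (R : realType) (V W : lmodType R) (f : V -> W)
    (lf : linear f) : {linear V -> W} :=
  HB.pack f (GRing.isLinear.Build R V W *:%R f lf).

Section Embedding.
Variables (R : realType) (X : completeNormedModType R) (x : nat -> X).
Hypotheses (x_neq0 : forall n, x n != 0) (x_le1 : forall n, `|x n| <= 1).
Hypothesis x_cvg0 : (fun n => `|x n|) @ \oo --> (0 : R).
Variables (Z : completeNormedModType R) (j : (R -> X) -> Z).
Hypothesis hZ : is_completion (calZ x) (calZnorm x) j.

Lemma stepP (s t a : R) (u v : X) :
  step s t (a *: u + v) = a *: step s t u + step s t v.
Proof.
apply/funext => r; rewrite /step scalerDr; congr (_ + _).
by rewrite scalerA mulrC -scalerA.
Qed.

Lemma completion0 : j 0 = 0.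
Proof.
have [jl _ _] := hZ; have c0 : calZ x 0 by exact: lin_span0.
by have := jl (-1) _ _ c0 c0; rewrite addr0 scaler0 scaleN1r addNr.
Qed.

Lemma completion_sum n (c : 'I_n -> R) (f : 'I_n -> R -> X) :
  (forall i, calZ x (f i)) ->
  j (\sum_(i < n) c i *: f i) = \sum_(i < n) c i *: j (f i).
Proof.
have [jl _ _] := hZ; elim: n => [|n IHn] in c f * => hf.
  by rewrite !big_ord0 completion0.
rewrite !big_ord_recl jl ?IHn => [//|i||]; [exact: hf|exact: hf|].
by apply: lin_span_sum => i; exact: hf.
Qed.

(** For [s < r] the norm of [w] in [Y r] is at most its norm in [Y s]; integrate
    over [(s, t)], whose length is at most [1]. *)
Lemma norm_step_le (s t tau : R) (w : X) : 0 < s -> s < t -> t < 1 ->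
  0 <= tau -> dilate tau (U x s) w -> `|j (step s t w)| <= tau.
Proof.
move=> s0 st t1 tau0 Uw; have [_ jN _] := hZ.
rewrite jN; last first.
  apply: calZ_step => //; have [u Uu <-] := Uw.
  by apply: lin_spanZ; exact: sub_lin_span.
apply: calZnorm_le => // r _; apply: step_dilate => sr.
by have [u Uu <-] := Uw; exists u => //; exact: (U_mono x_neq0 x_le1 sr).
Qed.

(** The map [y |-> y * chi_(s, t)] carries [phi] to a functional on [Y s], which
    need not be continuous for the norm of [X]. On the symmetric hull of [x],
    however, [sym_hull_dilate_U] gives the smallness condition under which
    [approx_functional] replaces it by a functional on [X]. *)
Lemma approx_functional_step (s t M d : R) (phi : {scalar Z}) :
  0 < s -> s < t -> t < 1 -> 0 <= M -> (forall z, `|phi z| <= M * `|z|) ->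
  0 < d -> exists (f : {scalar X}) (C : R), [/\ 0 <= C,
    (forall v, `|f v| <= C * `|v|) &
    forall n, `|f (x n) - phi (j (step s t (x n)))| <= d].
Proof.
move=> s0 st t1 M0 phiM d0; have [jl _ _] := hZ.
have [||||f [C [C0 fC fx]]] := @approx_functional R X (sym_hull x) (Y x s)
    (fun w => phi (j (step s t w))) (disk_sym_hull x) _ _ _ _ d d0.
- by move=> a u v; exact: lin_spanP.
- by move=> a u v Yu Yv; rewrite stepP jl ?linearP//; exact: calZ_step.
- by move=> v /(sym_hull_sub_U x_neq0 x_le1 (ltW s0)); exact: sub_lin_span.
- move=> e e0.
  have M1 : 0 < M + 1 by rewrite ltr_wpDl.
  have eM : 0 < e / (M + 1) by rewrite divr_gt0.
  have [C C0 hC] := sym_hull_dilate_U x_neq0 x_le1 x_cvg0 s0 eM.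
  exists (M * C); first exact: mulr_ge0.
  move=> v Kv; apply: le_trans (ler_norm _) _; apply: le_trans (phiM _) _.
  apply: (@le_trans _ _ (M * (e / (M + 1) + C * `|v|))).
    rewrite ler_wpM2l//; apply: norm_step_le => //; last exact: hC.
    by apply: addr_ge0; [rewrite ltW// divr_gt0|exact: mulr_ge0].
  rewrite mulrDr [M * (C * _)]mulrA lerD2r mulrCA ger_pMr// ler_pdivrMr//.
  by rewrite mul1r lerDl.
exists f, C; split=> // n; apply: fx; exact: sym_hull_gen.
Qed.

End Embedding.

Theorem proposition1 (R : realType) (X : completeNormedModType R)
  (hX : ~ approximation_property X)
  (x : nat -> X)
  (x_neq0 : forall n, x n != 0)
  (x_le1 : forall n, `|x n| <= 1)
  (x_decr : nonincreasing_seq (fun n => `|x n|))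
  (x_cvg0 : (fun n => `|x n|) @ \oo --> (0 : R))
  (hK : ~ id_approximable_on (closed_convex_hull (range x)))
  (Z : completeNormedModType R) (j : (R -> X) -> Z)
  (hZ : is_completion (calZ x) (calZnorm x) j) :
  ~ approximation_property Z.
Proof.
move=> APZ; apply: hK => eps eps0.
(* Any interval inside (0, 1) would do; here its length is [t - s = 1 / 3]. *)
pose s : R := 3^-1; pose t : R := 2 / 3.
have s0 : 0 < s by rewrite /s; lra.
have st : s < t by rewrite /s /t; lra.
have t1 : t < 1 by rewrite /t; lra.
pose z n := j (step s t (x n)).
have zle n : `|z n| <= `|x n| `^ s.
  by apply: (norm_step_le x_neq0 x_le1 hZ) => //; exact: x_dilate_U.
have z1 n : `|z n| <= 1.
  exact: le_trans (zle n) (normx_powR_le1 x_neq0 x_le1 n (ltW s0)).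
have z_cvg0 : z @ \oo --> (0 : Z).
  apply/cvgrPdist_le => d d0.
  have [N hN] := normx_powR_cvg0 x_cvg0 s0 d0.
  exists N => // n Nn /=; rewrite sub0r normrN.
  exact: le_trans (zle n) (hN n Nn).
(* The total error below is [3 * (e + 2 e) = 9 e < eps]. *)
pose e := eps / 12; have e0 : 0 < e by rewrite divr_gt0.
have [T [Tb [m [v0 Tv0]] TK]] := APZ _ (compact_cvg_range z_cvg0) e e0.
have [||phi [w [M [M0 phiM TE]]]] := finite_rank_decomposition (v := v0) _ Tb.
- by move=> a u v; rewrite linearP.
- by move=> u; apply: lin_span_range; apply: Tv0; exists u.
have [jl _ jdense] := hZ.
pose eta := e / (m%:R * M + 1).
have mM0 : 0 <= m%:R * M by rewrite mulr_ge0.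
have mM : 0 < m%:R * M + 1 by rewrite ltr_wpDl.
have eta0 : 0 < eta by rewrite divr_gt0.
have /choice[f hf] : forall i, exists f, calZ x f /\ `|w i - j f| <= eta.
  move=> i; have : closure (j @` calZ x) (w i) by rewrite jdense.
  move=> /(_ _ (nbhsx_ballx (w i) _ eta0))[_ [[f cf <-]]].
  by rewrite -ball_normE/= => /ltW; exists f.
have /choice[q hq] : forall i, exists q, weak_integral (f i) q.
  by move=> i; apply: calZ_weak_integral; exact: (hf i).1.
pose Q := \sum_(i < m) `|q i|.
have Q0 : 0 <= Q by exact: sumr_ge0.
have Q1 : 0 < Q + 1 by rewrite ltr_wpDl.
pose d := e / (Q + 1); have d0 : 0 < d by rewrite divr_gt0.
have /choice[g hg] : forall i, exists g : {scalar X}, exists C, [/\ 0 <= C,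
    (forall v, `|g v| <= C * `|v|) & forall n, `|g (x n) - phi i (z n)| <= d].
  move=> i; exact: (approx_functional_step x_neq0 x_le1 x_cvg0 hZ s0 st t1
    M0 (phiM i) d0).
have /choice[C hC] := hg.
have linS : linear (fun v => 3 *: \sum_(i < m) g i v *: q i).
  move=> a u v; rewrite scalerA mulrC -scalerA -scalerDr; congr (_ *: _).
  rewrite scaler_sumr -big_split; apply: eq_bigr => i _ /=.
  by rewrite linearP scalerDl scalerA.
have bS : bounded_op (linear_of linS).
  exists (3 * \sum_(i < m) C i * `|q i|) => v.
  rewrite normrZ ger0_norm// -mulrA ler_wpM2l//.
  apply: le_trans (ler_norm_sum _ _ _) _; rewrite mulr_suml ler_sum// => i _.
  by have [C0 gC _] := hC i; rewrite normrZ mulrAC ler_wpM2r.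
exists (linear_of linS); split => //.
  exists m, q => _ [v _ <-]; exists m, (fun i => 3 * g i v), q.
  split=> [i|]; first by exists i.
  by rewrite /= scaler_sumr; apply: eq_bigr => i _; rewrite scalerA.
move=> v /(approx_closed_convex_hull (e := 9 * e) bS) h.
apply: (@le_lt_trans _ _ (9 * e)); last by rewrite /e; lra.
apply: h => _ [n _ <-] /=.
(* The functionals: [g i (x n)] against [phi i (z n)]. *)
have err1 : `|\sum_(i < m) g i (x n) *: q i -
    \sum_(i < m) phi i (z n) *: q i| <= e.
  rewrite -sumrB; apply: le_trans (ler_norm_sum _ _ _) _.
  apply: (@le_trans _ _ (d * Q)).
    rewrite mulr_sumr ler_sum// => i _; rewrite -scalerBl normrZ ler_wpM2r//.
    by have [_ _ ->] := hC i.
  by rewrite /d mulrAC -mulrA ger_pMr// ler_pdivrMr// mul1r lerDl.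
(* The vectors of the finite rank operator: [w i] against [j (f i)]. *)
have err2 : `|\sum_(i < m) phi i (z n) *: j (f i) - z n| <= e + e.
  rewrite -(subrKA (T (z n))); apply: le_trans (ler_normD _ _) _.
  apply: lerD; last by apply/ltW/TK; right; exists n.
  rewrite TE -sumrB; apply: le_trans (ler_norm_sum _ _ _) _.
  apply: (@le_trans _ _ (\sum_(i < m) M * eta)).
    apply: ler_sum => i _; rewrite -scalerBr normrZ distrC ler_pM//.
      apply: le_trans (phiM i (z n)) _; rewrite -[leRHS]mulr1 ler_wpM2l//.
    exact: (hf i).2.
  rewrite sumr_const card_ord -mulr_natl mulrA /eta mulrCA ger_pMr//.
  by rewrite ler_pdivrMr// mul1r lerDl.
(* Transport [err2] to [X] by integration, which maps [step s t (x n)] to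
   [x n / 3] and [f i] to [q i]. *)
have err3 : `|\sum_(i < m) phi i (z n) *: q i - 3^-1 *: x n| <= e + e.
  pose F := \sum_(i < m) phi i (z n) *: f i.
  have cF : calZ x F by apply: lin_span_sum => i; exact: (hf i).1.
  have cx : calZ x (step s t (x n)).
    by apply: calZ_step => //; apply: sub_lin_span; exact: U_x (ltW s0).
  have wF : weak_integral (- 1 *: step s t (x n) + F)
      (- 1 *: ((t - s) *: x n) + \sum_(i < m) phi i (z n) *: q i).
    apply: weak_integralP; first exact: weak_integral_step.
    exact: weak_integral_sum.
  have := weak_integral_norm x_neq0 x_le1 (lin_spanP _ cx cF) wF.
  have [_ jN _] := hZ; rewrite -jN; last exact: lin_spanP.
  rewrite jl// (completion_sum hZ); last by move=> i; exact: (hf i).1.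
  have -> : t - s = 3^-1 by rewrite /t /s; lra.
  rewrite !scaleN1r ![- _ + _]addrC.
  by move=> /le_trans; apply.
have -> : 3 *: \sum_(i < m) g i (x n) *: q i - x n =
    3 *: (\sum_(i < m) g i (x n) *: q i - 3^-1 *: x n).
  by rewrite scalerBr scalerA divff ?scale1r// pnatr_eq0.
rewrite normrZ ger0_norm// -(subrKA (\sum_(i < m) phi i (z n) *: q i)).
by have := le_trans (ler_normD _ _) (lerD err1 err3); lra.
Qed.
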